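(* Let $\eta\in[0,2\pi)$ with $\eta\in\mathbb{Q}\pi$, and let $G$ be a $k$-regular weakly connected mixed graph with $p$ vertices, where $p$ is a prime number, equipped with its $\eta$-function $\theta$. Then $G$ is periodic if and only if $G^{\pm}$ is isomorphic to either the cycle graph $C_p$ or the path graph $P_2$.
   Context: A mixed graph $G=(V,\mathcal{A})$ consists of a finite vertex set $V$ and a subset $\mathcal{A} \subset V\times V \setminus \{(x,x) \mid x\in V\}$ of arcs. For an arc $a=(x,y)$, write $o(a)=x$, $t(a)=y$, $a^{-1}=(y,x)$. Let $\mathcal{A}^{-1}=\{a^{-1} \mid a\in\mathcal{A}\}$ and $\mathcal{A}^{\pm}=\mathcal{A}\cup\mathcal{A}^{-1}$. The underlying graph $G^{\pm}=(V,\mathcal{A}^{\pm})$ is regarded as an undirected simple graph; $G$ is weakly connected if $G^{\pm}$ is connected. Let $\deg_G x=\deg_{G^{\pm}}x$; $G$ is $k$-regular if $\deg_G x=k$ for all $x\in V$. Here $C_p$ is the cycle on $p\ge3$ vertices and $P_2$ is the path on $2$ vertices (a single edge). The $\eta$-function $\theta:\mathcal{A}^{\pm}\to\mathbb{R}$ of $G$ is defined by $\theta(a)=\eta$ if $a\in\mathcal{A}\setminus\mathcal{A}^{-1}$, $\theta(a)=-\eta$ if $a\in\mathcal{A}^{-1}\setminus\mathcal{A}$, and $\theta(a)=0$ if $a\in\mathcal{A}\cap\mathcal{A}^{-1}$. Define $K\in\mathbb{C}^{V\times\mathcal{A}^{\pm}}$ by $K_{x,a}=\frac{1}{\sqrt{\deg_G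 x}}\delta_{x,t(a)}$, $C=2K^*K-I$, $(S_\theta)_{a,b}=e^{\theta(b)i}\delta_{a,b^{-1}}$ for $a,b\in\mathcal{A}^{\pm}$, and the time evolution matrix $U_\theta=S_\theta C\in\mathbb{C}^{\mathcal{A}^{\pm}\times\mathcal{A}^{\pm}}$. The mixed graph $G$ (equipped with $\theta$) is periodic if there is a positive integer $\tau$ with $U_\theta^{\tau}=I$. *)

(* Defs.v *)
From HB Require Import structures.
From mathcomp Require Import all_boot all_order all_algebra.
From mathcomp Require Import complex.
From mathcomp Require Import reals trigo.

Set Implicit Arguments.
Unset Strict Implicit.
Unset Printing Implicit Defensive.

Import Order.TTheory GRing.Theory Num.Theory.
Local Open Scope ring_scope.
Local Open Scope complex_scope.

Record mixed_graph (V : finType) := MixedGraph {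
  arcs : {set V * V};
  arcs_loopless : forall x : V, (x, x) \notin arcs
}.

Definition arc_inv (V : finType) (a : V * V) : V * V := (a.2, a.1).

Definition sym_arcs (V : finType) (G : mixed_graph V) : {set V * V} :=
  arcs G :|: [set arc_inv a | a in arcs G].

(* The elements of A^{+-}, as a finite type; it indexes the rows and columns
   of the evolution matrix. *)
Definition sym_arc (V : finType) (G : mixed_graph V) : finType :=
  {a : V * V | a \in sym_arcs G}.

Definition terminus (V : finType) (G : mixed_graph V) (a : sym_arc G) : V :=
  (val a).2.

(* Adjacency of the underlying simple graph G^{+-}. *)
Definition underlying (V : finType) (G : mixed_graph V) : rel V :=
  fun x y => (x, y) \in sym_arcs G.

Definition weakly_connected (V : finType) (G : mixed_graph V) : Prop :=
  forall x y : V, connect (underlying G) x y.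

Definition degree (V : finType) (G : mixed_graph V) (x : V) : nat :=
  #|[set y | underlying G x y]|.

Definition k_regular (V : finType) (G : mixed_graph V) (k : nat) : Prop :=
  forall x : V, degree G x = k.

Definition graph_iso (V W : finType) (e : rel V) (f : rel W) : Prop :=
  exists2 h : V -> W, bijective h & forall x y : V, f (h x) (h y) = e x y.

(* Only a simple cycle for n >= 3. *)
Definition cycle_graph (n : nat) : rel 'I_n :=
  fun i j => (j == i.+1 %% n :> nat)%N || (i == j.+1 %% n :> nat)%N.

Definition path_graph (n : nat) : rel 'I_n :=
  fun i j => (j == i.+1 :> nat) || (i == j.+1 :> nat).

Definition eta_function (R : realType) (V : finType) (G : mixed_graph V)
    (eta : R) : sym_arc G -> R :=
  fun a =>
    if val a \in arcs G then
      if arc_inv (val a) \in arcs G then 0 else eta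
    else - eta.
Arguments eta_function {R V} G eta _.

Definition expi (R : realType) (t : R) : R[i] := cos t +i* sin t.

(* Matrices indexed by finite types are indexed by ordinals through the
   enumerations [enum_val]. *)
Definition K_mx (R : realType) (V : finType) (G : mixed_graph V) :
    'M[R[i]]_(#|V|, #|sym_arc G|) :=
  \matrix_(x, a)
    let v := enum_val x in
    ((Num.sqrt (degree G v)%:R)^-1)%:C
      * (v == terminus (enum_val a))%:R.

Definition coin_mx (R : realType) (V : finType) (G : mixed_graph V) :
    'M[R[i]]_#|sym_arc G| :=
  2%:R *: ((map_mx Num.conj (K_mx R G))^T *m K_mx R G) - 1%:M.

Definition shift_mx (R : realType) (V : finType) (G : mixed_graph V)
    (theta : sym_arc G -> R) : 'M[R[i]]_#|sym_arc G| :=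
  \matrix_(a, b)
    (expi (theta (enum_val b))
      * (val (enum_val a) == arc_inv (val (enum_val b)))%:R).

Definition evolution_mx (R : realType) (V : finType) (G : mixed_graph V)
    (theta : sym_arc G -> R) : 'M[R[i]]_#|sym_arc G| :=
  shift_mx theta *m coin_mx R G.

Definition mg_periodic (R : realType) (V : finType) (G : mixed_graph V)
    (theta : sym_arc G -> R) : Prop :=
  exists2 tau : nat, (0 < tau)%N & evolution_mx theta ^+ tau = 1%:M.

(* Main.v *)
Require Import Defs.
From mathcomp Require Import all_boot all_order all_fingroup all_algebra.
From mathcomp Require Import all_field.
From mathcomp Require Import complex.
From mathcomp Require Import reals trigo.
From mathcomp Require Import ring zify.
Set Implicit Arguments.
Unset Strict Implicit.
Unset Printing Implicit Defensive.
Import Order.TTheory GRing.Theory Num.Theory.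
Local Open Scope ring_scope.

(** The entry of [U] at [(a, b)] is
    [e^(i theta(a^-1)) * (2/k [o(a) = t(b)] - [a^-1 = b])], which makes both
    directions depend on the degree [k] alone: periodicity amounts to [k <= 2].

    Suppose [U^tau = 1]. Then [U] is diagonalizable with roots of unity as
    eigenvalues, so the second elementary symmetric function of its spectrum,
    [((tr U)^2 - tr U^2) / 2], is an algebraic integer.  A product
    [U_(a,b) U_(b,a)] vanishes unless [b = a^-1], where the two phases cancel;
    hence [tr U = 0] and [tr U^2 = p k (2/k - 1)^2], whatever [eta] is.  The
    symmetric function is therefore rational, hence an integer, and [2 k]
    divides [p (k - 2)^2].  As [0 < k < p] and [p] is prime, [k] divides [4],
    and [k = 4] would make [p] even ([periodic_degree_le2]).

    Conversely, for [k <= 2] the coin acts on the arcs entering a vertex as the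
    identity ([k = 1]) or as a swap ([k = 2]).  So [U] is a permutation matrix
    with roots of unity as weights, because [eta] is a rational multiple of
    [pi], and such a matrix has finite order ([small_degree_periodic]).

    A connected graph that is regular of degree [1] is an edge, and one that is
    regular of degree [2] is a cycle, found by walking without turning back
    until the first return ([one_regular_iso], [two_regular_iso]). *)

(** * Integrality of the spectrum of a matrix of finite order *)

Lemma integral_sum (R : comNzRingType) (K : fieldType)
    (f : {rmorphism R -> K}) (s : seq K) :
  {in s, integralRange f} -> integralOver f (\sum_(x <- s) x).
Proof.
elim: s => [|x s IHs] s_int; first by rewrite big_nil; apply: integral0.
rewrite big_cons; apply: integral_add; first exact/s_int/mem_head.
by apply: IHs => y sy; apply: s_int; rewrite inE sy orbT.
Qed.

(** The witness [z] is the second elementary symmetric function of [s];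
    stating it through the power sums lets it be read off from the traces of a
    matrix and of its square. *)
Lemma integral_e2 (R : comNzRingType) (K : fieldType)
    (f : {rmorphism R -> K}) (s : seq K) :
  {in s, integralRange f} ->
  exists2 z, integralOver f z
    & (\sum_(x <- s) x) ^+ 2 = \sum_(x <- s) x ^+ 2 + z *+ 2.
Proof.
elim: s => [|x s IHs] s_int.
  by exists 0; [exact: integral0 | rewrite !big_nil expr0n mul0rn addr0].
have s_int' : {in s, integralRange f}.
  by move=> y sy; apply: s_int; rewrite inE sy orbT.
have [z z_int Ez] := IHs s_int'.
exists (z + x * \sum_(y <- s) y).
  apply: integral_add => //; apply: integral_mul; first exact/s_int/mem_head.
  exact: integral_sum.
by rewrite !big_cons sqrrD Ez; ring.
Qed.

(** A monic integer polynomial with a rational root in [F] has the same root in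
    [algC], where rational algebraic integers are known to be integers. *)
Lemma integral_rat_int (F : numFieldType) (q : rat) :
  integralOver (intr : int -> F) (ratr q) -> q \is a Num.int.
Proof.
case=> P monP rootP.
have rootQ : root (map_poly (intr : int -> rat) P) q.
  have fmr : map_poly (ratr : rat -> F) (map_poly intr P) = map_poly intr P.
    by rewrite -map_poly_comp; apply: eq_map_poly => z; rewrite /= ratr_int.
  by rewrite -(fmorph_root (ratr : rat -> F)) fmr.
have rootC : root (map_poly (intr : int -> algC) P) (ratr q).
  have fmr : map_poly (ratr : rat -> algC) (map_poly intr P) = map_poly intr P.
    by rewrite -map_poly_comp; apply: eq_map_poly => z; rewrite /= ratr_int.
  by rewrite -fmr fmorph_root.
have: (ratr q : algC) \in Num.int.
  apply: Cint_rat_Aint; first exact: Crat_rat.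
  apply: (root_monic_Aint rootC); first exact: monic_map.
  by apply/polyOverP => i; rewrite coef_map intr_int.
move=> /intrP[m Em]; apply/intrP; exists m.
by apply: (fmorph_inj (ratr : rat -> algC)); rewrite /= Em ratr_int.
Qed.

Lemma diag_mxX (F : fieldType) n (d : 'rV[F]_n) m :
  diag_mx d ^+ m = diag_mx (\row_j d 0 j ^+ m).
Proof.
elim: m => [|m IHm]; first by apply/matrixP => i j; rewrite !mxE expr0.
rewrite exprS IHm -mulmxE mulmx_diag; congr diag_mx.
by apply/rowP => j; rewrite !mxE exprS.
Qed.

(** The minimal polynomial divides [X^tau - 1], which is separable in
    characteristic zero. *)
Lemma finite_order_diagonalizable (F : numClosedFieldType) n (A : 'M[F]_n.+1)
    tau :
  (0 < tau)%N -> A ^+ tau = 1 -> diagonalizable A.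
Proof.
move=> tau_gt0 Atau; apply/diagonalizableP.
have [r Er] := closed_field_poly_normal ('X^tau - 1 : {poly F}).
rewrite (monicP (monicXnsubC 1 tau_gt0)) scale1r in Er.
exists r.
  rewrite -separable_prod_XsubC -Er separable_Xn_sub_1 //.
  by rewrite pnatr_eq0 -lt0n.
rewrite -Er; apply: mxminpoly_min.
by rewrite rmorphB rmorph1 rmorphXn /= horner_mx_X Atau subrr.
Qed.

(** Here [z] is the coefficient [e_2] of the characteristic polynomial: its
    roots, being roots of unity, are algebraic integers. *)
Lemma finite_order_e2_integral (F : numClosedFieldType) n (A : 'M[F]_n) tau :
  (0 < tau)%N -> A ^+ tau = 1%:M ->
  exists2 z, integralOver (intr : int -> F) z
    & (\tr A) ^+ 2 = \tr (A *m A) + z *+ 2.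
Proof.
case: n A => [|n] A tau_gt0 Atau.
  exists 0; first exact: integral0.
  by rewrite /mxtrace !big_ord0 expr0n mul0rn addr0.
have [P Pu /diagonalizable_forPex[d /(simmxP Pu) PA]] :=
  finite_order_diagonalizable tau_gt0 Atau.
have PAX m : P *m A ^+ m = diag_mx d ^+ m *m P.
  elim: m => [|m IHm]; first by rewrite !expr0 mulmx1 mul1mx.
  by rewrite !exprSr -!mulmxE mulmxA IHm -!mulmxA PA.
have trAX m : \tr (A ^+ m) = \sum_i d 0 i ^+ m.
  have -> : A ^+ m = invmx P *m (diag_mx d ^+ m *m P) by rewrite -PAX mulKmx.
  rewrite mxtrace_mulC -mulmxA mulmxV // mulmx1 diag_mxX mxtrace_diag.
  by apply: eq_bigr => i _; rewrite mxE.
have dtau i : d 0 i ^+ tau = 1.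
  have /(congr1 (mulmx^~ (invmx P))) := PAX tau.
  rewrite Atau mulmx1 mulmxK // mulmxV // diag_mxX => /matrixP/(_ i i).
  by rewrite !mxE eqxx mulr1n.
have d_int : {in [seq d 0 i | i <- index_enum 'I_n.+1],
    integralRange (intr : int -> F)}.
  move=> _ /mapP[i _ ->]; apply: (integral_root_monic (p := 'X^tau - 1)).
  - exact: monicXnsubC.
  - by rewrite rootE !hornerE dtau subrr.
  - apply/integral_poly => j; rewrite coefB coefXn coef1.
    by apply: integral_sub; apply: integral_nat.
have [z z_int Ez] := integral_e2 d_int.
exists z => //; move: Ez; rewrite !big_map => Ez.
by rewrite mulmxE -expr2 -[in \tr A](expr1 A) !trAX -Ez.
Qed.

(** * Phases *)

Section Phases.
Local Open Scope complex_scope.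
Variable R : realType.
Implicit Types t : R.

Lemma expi0 : expi (0 : R) = 1.
Proof. by rewrite /expi cos0 sin0. Qed.

Lemma expiD t u : expi (t + u) = expi t * expi u.
Proof.
rewrite /expi cosD sinD; apply/eqP; rewrite eq_complex /=.
by apply/andP; split; apply/eqP; rewrite // addrC.
Qed.

Lemma expiMn t m : expi (t *+ m) = expi t ^+ m.
Proof.
elim: m => [|m IHm]; first by rewrite mulr0n expi0.
by rewrite mulrS expiD IHm exprS.
Qed.

Lemma expiNK t : expi t * expi (- t) = 1.
Proof. by rewrite -expiD subrr expi0. Qed.

Lemma expi2pi : expi (pi *+ 2 : R) = 1.
Proof. by rewrite /expi cos2pi sin2pi. Qed.

Lemma expi_root_of_unity t (q : rat) :
  0 <= t -> t = ratr q * pi -> exists2 N, (0 < N)%N & expi t ^+ N = 1.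
Proof.
move=> t_ge0 Et.
have q_ge0 : 0 <= q.
  by move: t_ge0; rewrite Et pmulr_lge0 ?pi_gt0 // ler0q.
pose b := `|denq q|%N; pose a := `|numq q|%N.
have b_gt0 : (0 < b)%N by rewrite absz_gt0 denq_neq0.
exists (b * 2)%N; first by rewrite muln_gt0 b_gt0.
have Eqb : q *+ b = a%:R.
  rewrite -[LHS]mulr_natr -[X in X * _]divq_num_den.
  rewrite -[b%:R]/(b%:Z%:~R) -[a%:R]/(a%:Z%:~R) !gez0_abs ?numq_ge0 //.
  by rewrite divfK // intr_eq0 denq_neq0.
rewrite -expiMn Et mulrnA -mulrnAl -[ratr q *+ b]raddfMn /= Eqb ratr_nat.
by rewrite mulr_natl -mulrnA mulnC mulrnA expiMn expi2pi expr1n.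
Qed.

End Phases.

(** * Arcs of the symmetric closure *)

Section Arcs.
Variables (V : finType) (G : mixed_graph V).

Lemma arc_invK : involutive (@arc_inv V).
Proof. by case. Qed.

Lemma sym_arcs_inv a : (arc_inv a \in sym_arcs G) = (a \in sym_arcs G).
Proof.
rewrite !inE orbC; congr (_ || _).
  by rewrite mem_imset //; apply: inv_inj arc_invK.
by rewrite -[a in RHS]arc_invK mem_imset //; apply: inv_inj arc_invK.
Qed.

Lemma underlying_sym : symmetric (underlying G).
Proof. by move=> x y; rewrite /underlying -sym_arcs_inv. Qed.

Lemma underlying_irrefl : irreflexive (underlying G).
Proof.
move=> x; apply/negbTE; rewrite /underlying !inE negb_or arcs_loopless /=.
apply/imsetP => -[[y z] yz [Ey Ez]].
by move: yz; rewrite -Ey -Ez (negbTE (arcs_loopless G x)).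
Qed.

Fact rev_arc_subproof (a : sym_arc G) : arc_inv (val a) \in sym_arcs G.
Proof. by rewrite sym_arcs_inv (valP a). Qed.

Definition rev_arc (a : sym_arc G) : sym_arc G :=
  Sub (arc_inv (val a)) (rev_arc_subproof a).

Definition origin (a : sym_arc G) : V := (val a).1.

Lemma rev_arcK : involutive rev_arc.
Proof. by move=> a; apply: val_inj; rewrite /= arc_invK. Qed.

Lemma terminus_rev a : terminus (rev_arc a) = origin a.
Proof. by []. Qed.

Lemma eq_arc a b : origin a = origin b -> terminus a = terminus b -> a = b.
Proof.
move: a b => [[x y] xyP] [[z t] ztP]; rewrite /origin /terminus /= => Ex Ey.
by apply: val_inj; rewrite /= Ex Ey.
Qed.

Lemma origin_neq_terminus a : origin a != terminus a.
Proof.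
apply/eqP => Ea; have := valP a; rewrite /origin /terminus in Ea.
rewrite [X in X \in _]surjective_pairing -Ea.
by rewrite -[_ \in _]/(underlying G _ _) underlying_irrefl.
Qed.

Lemma card_terminus x : #|[set a : sym_arc G | terminus a == x]| = degree G x.
Proof.
rewrite /degree -(@card_in_imset _ _ origin).
  apply: eq_card => y; rewrite !inE; apply/imsetP/idP.
    case=> a; rewrite inE => /eqP <- ->; rewrite underlying_sym /underlying.
    by rewrite -surjective_pairing (valP a).
  move=> xy; rewrite underlying_sym in xy.
  by exists (Sub (y, x) xy); rewrite // inE.
move=> a b; rewrite !inE => /eqP Ea /eqP Eb Eab; apply: eq_arc => //.
by rewrite Ea Eb.
Qed.

Lemma card_sym_arc k : k_regular G k -> #|sym_arc G| = (#|V| * k)%N.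
Proof.
move=> Gk; rewrite -sum1_card (partition_big (@terminus V G) predT) //=.
rewrite -sum_nat_const; apply: eq_bigr => x _.
by rewrite sum1_card -(Gk x) -card_terminus cardsE.
Qed.

End Arcs.

Lemma eta_function_rev (R : realType) (V : finType) (G : mixed_graph V)
    (eta : R) (a : sym_arc G) :
  eta_function G eta (rev_arc a) = - eta_function G eta a.
Proof.
have := valP a; rewrite /eta_function /= arc_invK !inE.
rewrite -[val a in X in _ || X]arc_invK mem_imset; last first.
  exact: inv_inj (@arc_invK V).
by do 2!case: ifP; rewrite ?oppr0 ?opprK.
Qed.

(** * The evolution matrix of a regular mixed graph *)

Section Evolution.
Local Open Scope complex_scope.
Variables (R : realType) (V : finType) (G : mixed_graph V) (k : nat).
Hypothesis Gk : k_regular G k.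
Implicit Types (theta : sym_arc G -> R) (b c : sym_arc G)
  (i j : 'I_#|sym_arc G|).
Notation arc := (@enum_val (sym_arc G) (sym_arc G)).

(** The coin matrix of a [k]-regular graph, with arcs in place of the indices
    that enumerate them. *)
Definition coin (b c : sym_arc G) : R[i] :=
  2%:R / k%:R * (terminus b == terminus c)%:R - (b == c)%:R.

Lemma coin_mxE i j : coin_mx R G i j = coin (arc i) (arc j).
Proof.
rewrite 4!mxE [1%:M i j]mxE /coin.
rewrite [arc i == arc j](inj_eq enum_val_inj); congr (_ - _).
rewrite -mulrA; congr (_ * _).
pose r v : R[i] := ((Num.sqrt (degree G v)%:R)^-1)%:C.
pose f v : R[i] := Num.conj (r v * (v == terminus (arc i))%:R) *
  (r v * (v == terminus (arc j))%:R).
transitivity (\sum_(v in V) f v).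
  by rewrite [RHS]big_enum_val; apply: eq_bigr => x _; rewrite !mxE.
rewrite (bigD1 (terminus (arc i))) //= big1 => [|v /negbTE ne_v]; last first.
  by rewrite /f ne_v mulr0 rmorph0 mul0r.
rewrite addr0 /f /r eqxx mulr1 Gk mulrA; congr (_ * _).
rewrite (_ : Num.conj _ = ((Num.sqrt k%:R)^-1)%:C); last first.
  by apply: conj_Creal; apply/complex_realP; eexists.
rewrite -rmorphM /= -invfM -expr2 sqr_sqrtr ?ler0n //.
by rewrite fmorphV /= rmorph_nat.
Qed.

Lemma evolution_mxE theta i j :
  evolution_mx theta i j =
  expi (theta (rev_arc (arc i))) * coin (rev_arc (arc i)) (arc j).
Proof.
rewrite mxE (bigD1 (enum_rank (rev_arc (arc i)))) //= big1 => [|d ne_d].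
  rewrite addr0 [shift_mx _ _ _]mxE coin_mxE enum_rankK /= arc_invK eqxx.
  by rewrite mulr1.
rewrite [shift_mx _ _ _]mxE; case: eqP => [E|]; last by rewrite mulr0 mul0r.
case/eqP: ne_d; apply: (canRL (@enum_valK _)).
by rewrite (_ : arc i = rev_arc (arc d)) ?rev_arcK //; apply: val_inj.
Qed.

Lemma coin_revr b : coin (rev_arc b) b = 0.
Proof.
rewrite /coin terminus_rev (negbTE (origin_neq_terminus b)) mulr0.
case: eqP => [Eb|]; last by rewrite subr0.
by have := origin_neq_terminus b; rewrite -[X in origin X]Eb eqxx.
Qed.

Lemma coin_diag b : coin b b = 2%:R / k%:R - 1.
Proof. by rewrite /coin !eqxx mulr1. Qed.

(** If both factors had a nonzero diffusion part then [b] and [c] would have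
    swapped endpoints; a return [U_(b,c) U_(c,b)] can only go through the
    reversed arc. *)
Lemma coin_mul_eq0 b c :
  c != rev_arc b -> coin (rev_arc b) c * coin (rev_arc c) b = 0.
Proof.
move=> ne_cb.
have ne_bc : b != rev_arc c.
  by apply: contra ne_cb => /eqP->; rewrite rev_arcK.
rewrite /coin !terminus_rev [rev_arc b == c]eq_sym [rev_arc c == b]eq_sym.
rewrite (negbTE ne_cb) (negbTE ne_bc) !subr0.
have [Ebc|] := eqVneq (origin b) (terminus c); last by rewrite mulr0 mul0r.
have [Ecb|] := eqVneq (origin c) (terminus b); last by rewrite !mulr0.
by case/eqP: ne_cb; apply: eq_arc.
Qed.

Lemma evolution_trace theta : \tr (evolution_mx theta) = 0.
Proof. by apply: big1 => i _; rewrite evolution_mxE coin_revr mulr0. Qed.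

(** Only the pairs (arc, reversed arc) contribute, and there the phases are
    opposite: the trace does not see [theta]. *)
Lemma evolution_sqr_trace theta :
  (forall e, theta (rev_arc e) = - theta e) ->
  \tr (evolution_mx theta *m evolution_mx theta) =
    (#|V| * k)%:R * (2%:R / k%:R - 1) ^+ 2.
Proof.
move=> theta_rev; rewrite -(card_sym_arc Gk) -[in RHS](card_ord #|_|).
rewrite mulr_natl -sumr_const; apply: eq_bigr => i _; rewrite mxE.
rewrite (bigD1 (enum_rank (rev_arc (arc i)))) //= big1 => [|d ne_d].
  rewrite addr0 !evolution_mxE enum_rankK rev_arcK !coin_diag mulrACA.
  by rewrite theta_rev [expi _ * _]mulrC expiNK mul1r.
rewrite !evolution_mxE mulrACA coin_mul_eq0 ?mulr0 //.
by apply: contra ne_d => /eqP <-; rewrite enum_valK.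
Qed.

(** The coin block at a vertex is [2/k J - 1] with [J] the all-one [k x k]
    matrix: the identity for [k = 1], the swap of two arcs for [k = 2].  No
    larger degree gives a permutation. *)
Lemma coin_involution : (0 < k <= 2)%N ->
  exists2 g : sym_arc G -> sym_arc G,
    involutive g & forall b c, coin b c = (c == g b)%:R.
Proof.
pose into b := [set c : sym_arc G | terminus c == terminus b].
have card_into b : #|into b| = k by rewrite card_terminus Gk.
have into_id b : b \in into b by rewrite inE.
have coinE b c : coin b c = 2%:R / k%:R * (c \in into b)%:R - (c == b)%:R.
  by rewrite /coin inE [terminus b == _]eq_sym [b == c]eq_sym.
case/andP; case Ek: k => [|[|[|]]] // _ _.
  exists id => // b c; rewrite coinE Ek divr1.
  have /eqP/cards1P[d Ed] := etrans (card_into b) Ek.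
  have := into_id b; rewrite Ed !inE => /eqP <-.
  by case: (c == b); [ring | ring].
have coin2 b c : coin b c = (c \in into b :\ b)%:R.
  rewrite coinE Ek divff ?pnatr_eq0 // mul1r in_setD1.
  by have [->|_] := eqVneq c b; rewrite ?into_id ?subrr ?subr0.
have card_rest b : #|into b :\ b| = 1%N.
  by have := cardsD1 b (into b); rewrite card_into Ek into_id => -[].
pose g b := odflt b [pick c in into b :\ b].
have gP b c : (c \in into b :\ b) = (c == g b).
  have /eqP/cards1P[d Ed] := card_rest b.
  rewrite /g; case: pickP => [e|/(_ d)] /=; rewrite Ed ?inE ?eqxx //.
  by move=> /eqP ->.
exists g => [b|b c]; last by rewrite coin2 gP.
apply/esym/eqP; rewrite -gP; have := eqxx (g b); rewrite -gP !inE.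
by rewrite eq_sym [terminus _ == _]eq_sym.
Qed.

End Evolution.

(** Raising to the order of the permutation leaves a diagonal matrix, whose
    entries are products of weights and thus still [N]-th roots of unity. *)
Lemma monomial_finite_order (F : fieldType) n (d : 'rV[F]_n) (s : 'S_n) N :
    (0 < N)%N -> (forall i, d 0 i ^+ N = 1) ->
  exists2 tau, (0 < tau)%N & (diag_mx d *m perm_mx s) ^+ tau = 1%:M.
Proof.
move=> N_gt0 dN.
have perm_diag (t : 'S_n) (e : 'rV[F]_n) :
    perm_mx t *m diag_mx e = diag_mx (\row_i e 0 (t i)) *m perm_mx t.
  rewrite -row_permE mul_diag_mx; apply/matrixP => i j; rewrite !mxE.
  by rewrite mulr_natr.
have powM m : exists2 e : 'rV[F]_n, forall i, e 0 i ^+ N = 1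
    & (diag_mx d *m perm_mx s) ^+ m = diag_mx e *m perm_mx (s ^+ m)%g.
  elim: m => [|m [e eN IHm]].
    exists (const_mx 1) => [i|]; first by rewrite mxE expr1n.
    by rewrite expg0 perm_mx1 mulmx1 diag_const_mx.
  exists (\row_i (e 0 i * d 0 ((s ^+ m)%g i))) => [i|].
    by rewrite mxE exprMn eN dN mulr1.
  rewrite exprSr IHm -mulmxE -mulmxA [perm_mx _ *m _]mulmxA perm_diag !mulmxA.
  rewrite mulmx_diag -mulmxA -perm_mxM expgSr; congr (diag_mx _ *m _).
  by apply/rowP => i; rewrite !mxE.
have [e eN Em] := powM #[s]%g.
exists (#[s]%g * N)%N; first by rewrite muln_gt0 order_gt0.
rewrite exprM Em expg_order perm_mx1 mulmx1.
rewrite diag_mxX -diag_const_mx; congr diag_mx.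
by apply/rowP => i; rewrite !mxE eN.
Qed.

(** Row [b] of [U] has its only nonzero entry in the column that the coin
    involution assigns to [b^-1], where it is the phase of [b^-1]. *)
Lemma small_degree_periodic (R : realType) (V : finType) (G : mixed_graph V)
    (k : nat) (theta : sym_arc G -> R) N :
    k_regular G k -> (0 < k <= 2)%N -> (0 < N)%N ->
    (forall e, expi (theta e) ^+ N = 1) ->
  mg_periodic theta.
Proof.
move=> Gk k12 N_gt0 thetaN; have [g gK coinE] := coin_involution R Gk k12.
pose s0 (i : 'I_#|sym_arc G|) : 'I_#|sym_arc G| :=
  enum_rank (g (rev_arc (enum_val i))).
have s0_inj : injective s0.
  move=> i j /enum_rank_inj /(inv_inj gK) /(inv_inj (@rev_arcK V G)).
  exact: enum_val_inj.
pose d := \row_i expi (theta (rev_arc (enum_val i))) : 'rV[R[i]]_#|sym_arc G|.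
have EU : evolution_mx theta = diag_mx d *m perm_mx (perm s0_inj).
  apply/matrixP => i j.
  rewrite (evolution_mxE Gk) coinE mul_diag_mx !mxE permE.
  by rewrite /s0 (can2_eq enum_rankK enum_valK) eq_sym.
have [|tau tau_gt0 Etau] := @monomial_finite_order _ _ d (perm s0_inj) N N_gt0.
  by move=> i; rewrite mxE.
by exists tau => //; rewrite EU.
Qed.

(** Modulo [k] the hypothesis says that [k] divides [4 p], hence [4]; the factor
    [2] on its left-hand side is what rules out [k = 4], since it forces [p] to
    be even. *)
Lemma admissible_degree p k m : prime p -> (0 < k < p)%N ->
  m * (2 * k)%N%:Z = p%:Z * (2 - k%:Z) ^+ 2 -> (k <= 2)%N.
Proof.
move=> p_prime /andP[k_gt0 k_lt_p] Em.
have k_dvd_4p : (k %| p * 4)%N.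
  suff : (k%:Z %| (p * 4)%N%:Z)%Z by [].
  (* (2 - k)^2 = 4 - k (4 - k) *)
  apply/dvdzP; exists (m * 2 + p%:Z * (4 - k%:Z)).
  rewrite !PoszM in Em *; move: Em; nia.
have co_kp : coprime k p.
  by rewrite coprime_sym prime_coprime // gtnNdvd.
rewrite Gauss_dvdr // in k_dvd_4p.
have : k \in divisors 4 by rewrite -dvdn_divisors.
rewrite !inE => /or3P[] /eqP Ek; rewrite ?Ek //.
move: Em k_lt_p; rewrite Ek => Em p_gt4.
have p_even : (2 %| p)%N by apply/dvdnP; exists `|m|%N; lia.
by move: p_even p_gt4; rewrite dvdn_prime2 // => /eqP <-.
Qed.

(** The traces of [U] and [U^2] do not depend on [theta], so neither does the
    rational number that has to be an algebraic integer. *)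
Lemma periodic_degree_le2 (R : realType) (V : finType) (G : mixed_graph V)
    (k : nat) (theta : sym_arc G -> R) :
    k_regular G k -> prime #|V| -> (0 < k < #|V|)%N ->
    (forall e, theta (rev_arc e) = - theta e) ->
  mg_periodic theta -> (k <= 2)%N.
Proof.
move=> Gk p_prime k_lt_p theta_rev [tau tau_gt0 Utau].
have [z z_int] := finite_order_e2_integral tau_gt0 Utau.
rewrite (evolution_trace Gk) (evolution_sqr_trace Gk theta_rev) => Ez.
(* Since tr U = 0, the integral element z is half of -tr(U^2). *)
pose q : rat := - ((#|V| * k)%:R * (2%:R / k%:R - 1) ^+ 2 / 2%:R).
have Eq : z = ratr q.
  have -> : z = - ((#|V| * k)%:R * (2%:R / k%:R - 1) ^+ 2 / 2%:R).
    have /eqP := Ez; rewrite expr0n eq_sym addr_eq0 => /eqP ->.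
    by rewrite mulNr opprK -(mulr_natr z) mulfK // pnatr_eq0.
  rewrite /q rmorphN /= fmorph_div (rmorphM (@ratr R[i])) rmorphXn rmorphB.
  by rewrite fmorph_div /= !ratr_nat rmorph1.
rewrite Eq in z_int; have /intrP[m Em] := integral_rat_int z_int.
(* z = m, cleared of the denominators of -p k (2/k - 1)^2 / 2 *)
apply: (admissible_degree (m := - m) p_prime k_lt_p).
apply: (intr_inj (R := rat)).
have k_neq0 : k%:R != 0 :> rat by rewrite pnatr_eq0 -lt0n; case/andP: k_lt_p.
rewrite rmorphM rmorphN /= -Em rmorphM rmorphXn rmorphB /= /q.
rewrite -!pmulrn !natrM.
by field.
Qed.

(** * Connected regular graphs of degree one and two *)

Definition regular_rel (V : finType) (e : rel V) (k : nat) : Prop :=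
  forall x, #|[set y | e x y]| = k.

Lemma graph_iso_regular (V W : finType) (e : rel V) (f : rel W) k l :
  graph_iso e f -> regular_rel e k -> regular_rel f l -> V -> k = l.
Proof.
move=> [h [h' hK h'K] hE] Ve Wf x; rewrite -(Ve x) -(Wf (h x)).
rewrite -(card_imset _ (can_inj hK)); apply: eq_card => z; rewrite !inE.
by rewrite -[z in LHS]h'K mem_imset ?inE -?hE ?h'K //; apply: can_inj hK.
Qed.

Lemma cycle_graphE n (i j : 'I_n) :
  cycle_graph i j = (j \in [set ordS i; ord_pred i]).
Proof.
rewrite !inE /cycle_graph; congr (_ || _).
by rewrite eq_sym; apply: can2_eq (@ordSK n) (@ord_predK n) j i.
Qed.

Lemma ordS_neq_pred n (i : 'I_n) : (3 <= n)%N -> ordS i != ord_pred i.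
Proof.
move=> n_ge3; apply/eqP => /(congr1 (@ordS n)); rewrite ord_predK.
move=> /(congr1 val) /eqP /=; rewrite -addn1 modnDml addn1 -addn2.
rewrite -[X in _ == X](modn_small (ltn_ord i)).
by rewrite -[X in _ == (X %% _)%N]addn0 eqn_modDl mod0n modn_small.
Qed.

Lemma cycle_graph_regular n : (3 <= n)%N -> regular_rel (@cycle_graph n) 2.
Proof.
move=> n_ge3 i; have -> : [set j | cycle_graph i j] = [set ordS i; ord_pred i].
  by apply/setP => j; rewrite inE cycle_graphE.
by rewrite cards2 ordS_neq_pred.
Qed.

Lemma path_graph2E (i j : 'I_2) : path_graph i j = (i != j).
Proof. by case: i => [[|[|i]] ?] //; case: j => [[|[|j]] ?]. Qed.

Lemma path_graph2_regular : regular_rel (@path_graph 2) 1.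
Proof.
move=> i; have -> : [set j | path_graph i j] = [set~ i].
  by apply/setP => j; rewrite !inE path_graph2E eq_sym.
by rewrite cardsC1 card_ord.
Qed.

Section RegularGraph.
Variables (V : finType) (e : rel V).
Hypotheses (e_sym : symmetric e) (e_irr : irreflexive e).

Lemma regular_lt_card k : regular_rel e k -> V -> (k < #|V|)%N.
Proof.
move=> Ve x; rewrite -(Ve x) -(ltn_predK (_ : (0 < #|V|)%N)) ?ltnS; last first.
  by apply/card_gt0P; exists x.
rewrite -(cardsC1 x); apply/subset_leq_card/subsetP => y; rewrite !inE.
by apply: contraTneq => ->; rewrite e_irr.
Qed.

Hypothesis e_conn : forall x y, connect e x y.

Lemma connected_closed_full (A : {set V}) x :
  x \in A -> (forall y z, y \in A -> e y z -> z \in A) -> A = setT.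
Proof.
move=> Ax A_closed; apply/setP => y; rewrite inE.
have /connectP[s s_path ->] := e_conn x y.
elim: s x Ax s_path => //= z s IHs x Ax /andP[xz]; apply: IHs.
exact: A_closed xz.
Qed.

Lemma connected_regular_gt0 k :
  regular_rel e k -> (1 < #|V|)%N -> (0 < k)%N.
Proof.
move=> Ve V_gt1; rewrite lt0n; apply/eqP => k0.
have /card_gt0P[x _] := ltnW V_gt1.
have : [set x] = setT.
  apply: (@connected_closed_full _ x) => [|y z _ yz]; first exact: set11.
  have /eqP := Ve y; rewrite k0 cards_eq0 => /eqP/setP/(_ z).
  by rewrite !inE yz.
move/(congr1 (fun A : {set V} => #|A|)); rewrite cards1 cardsT => V1.
by rewrite -V1 in V_gt1.
Qed.

Lemma one_regular_iso : regular_rel e 1 -> V -> graph_iso e (@path_graph 2).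
Proof.
move=> Ve x; have /eqP/cards1P[y Ny] := Ve x.
have exy : e x y by have /setP/(_ y) := Ny; rewrite !inE eqxx.
have Nyx : [set z | e y z] = [set x].
  apply/esym/eqP; rewrite eqEcard Ve cards1 andbT sub1set inE.
  by rewrite e_sym.
have card2 : #|V| = 2.
  rewrite -cardsT -(@connected_closed_full [set x; y] x) ?set21 //.
    by rewrite cards2; case: eqP exy => // ->; rewrite e_irr.
  move=> z t; rewrite !inE => /orP[] /eqP-> et.
    by have /setP/(_ t) := Ny; rewrite !inE et => <-; rewrite orbT.
  by have /setP/(_ t) := Nyx; rewrite !inE et => <-.
exists (fun z => cast_ord card2 (enum_rank z)) => [|z t].
  exists (fun i => enum_val (cast_ord (esym card2) i)) => [z|i].
    by rewrite cast_ordK enum_rankK.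
  by rewrite enum_valK cast_ordKV.
rewrite path_graph2E (inj_eq (@cast_ord_inj _ _ _)) (inj_eq enum_rank_inj).
have /setP/(_ t) : [set t | e z t] = [set~ z].
  apply/eqP; rewrite eqEcard Ve cardsC1 card2 andbT.
  by apply/subsetP => s; rewrite !inE; apply: contraTneq => ->; rewrite e_irr.
by rewrite !inE eq_sym.
Qed.

(** In a 2-regular graph a vertex entered from [x] is left through its only
    other neighbour, which determines the walk from its first edge. *)
Lemma nonbacktracking_walk : regular_rel e 2 -> V ->
  exists w : nat -> V, [/\ forall i, e (w i) (w i.+1),
    forall i, w i.+2 != w i
    & forall i z, e (w i.+1) z -> z = w i \/ z = w i.+2].
Proof.
move=> Ve x0; pose next x y := odflt y [pick z | e y z && (z != x)].
have nextP x y : e x y -> [/\ e y (next x y), next x y != x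
    & forall z, e y z -> z = x \/ z = next x y].
  move=> xy; have /eqP/cards2P[a [b [ne_ab Ny]]] := Ve y.
  have eyE z : e y z = (z == a) || (z == b).
    by have /setP/(_ z) := Ny; rewrite !inE.
  rewrite /next; case: pickP => [c /andP[yc ne_cx]|none] /=.
    split=> // z yz.
    move: yz yc xy ne_cx; rewrite [e x y]e_sym !eyE.
    by do 3!case/orP=> /eqP->; rewrite ?eqxx //; auto.
  have := none a; have := none b; rewrite !eyE !eqxx orbT /=.
  by move=> /negbFE/eqP eb /negbFE/eqP ea; rewrite ea eb eqxx in ne_ab.
have [y0 x0y0] : exists y, e x0 y.
  have /card_gt0P[y] : (0 < #|[set y | e x0 y]|)%N by rewrite Ve.
  by rewrite inE; exists y.
pose st i := iter i (fun s : V * V => (s.2, next s.1 s.2)) (x0, y0).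
have st_e i : e (st i).1 (st i).2.
  by elim: i => //= i IHi; have [] := nextP _ _ IHi.
exists (fun i => (st i).1); split=> i //=.
  by have [] := nextP _ _ (st_e i).
by move=> z; have [_ _] := nextP _ _ (st_e i); apply.
Qed.

Lemma first_return (w : nat -> V) :
  exists n j, [/\ (j < n)%N, w j = w n
    & forall a b, (a < n)%N -> (b < n)%N -> w a = w b -> a = b].
Proof.
pose returns n := [exists j : 'I_n, w j == w n].
have ex_ret : exists n, returns n.
  case: (pickP (fun n : 'I_#|V|.+1 => returns n)) => [n ?|none].
    by exists n.
  have w_inj : injective (fun i : 'I_#|V|.+1 => w i).
    move=> a b; wlog lt_ab : a b / (a < b)%N => [IH|Eab].
      case: (ltngtP a b) => [/IH//|lt_ba Eab|/val_inj //].
      by apply/esym/IH.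
    by have /existsP[] := none b; exists (Ordinal lt_ab); apply/eqP.
  by have := leq_card _ w_inj; rewrite card_ord ltnn.
case: (ex_minnP ex_ret) => n /existsP[j /eqP Ej] n_min.
exists n, j; split=> // a b lt_an lt_bn.
wlog lt_ab : a b lt_an lt_bn / (a < b)%N => [IH|Eab].
  by case: (ltngtP a b) => // [lt_ab | lt_ba Eab]; [|apply/esym]; apply: IH.
have : returns b by apply/existsP; exists (Ordinal lt_ab); apply/eqP.
by move/n_min; rewrite leqNgt lt_bn.
Qed.

(** At its first return the walk is back at its starting point: a return to an
    inner vertex would give that vertex a third neighbour.  The closed walk then
    contains both neighbours of each of its vertices, so by connectedness it
    exhausts the graph. *)
Lemma two_regular_iso : regular_rel e 2 -> V -> graph_iso e (@cycle_graph #|V|).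
Proof.
move=> Ve x0; have V_ge3 := regular_lt_card Ve x0.
have [w [w_e w_nb w_N]] := nonbacktracking_walk Ve x0.
have [n [j [lt_jn Ejn w_inj]]] := first_return w.
(* No loop and no step back, so no return before the third step. *)
have n_ge3 : (3 <= n)%N.
  case: n lt_jn Ejn w_inj => [|[|[|]]] // lt_jn Ejn _.
    by case: j lt_jn Ejn => // _ E; have := w_e 0; rewrite E e_irr.
  case: j lt_jn Ejn => [|[|]] // _ E.
    by have := w_nb 0; rewrite E eqxx.
  by have := w_e 1; rewrite E e_irr.
(* Otherwise w (n - 1) is a neighbour of w j, hence equal to w (j - 1), against
   the minimality of n, or to w (j + 1), which makes the walk turn back or
   stand still just before its return. *)
have j0 : j = 0.
  case: j lt_jn Ejn => // j lt_jn Ejn.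
  have w_pred : e (w j.+1) (w n.-1).
    by rewrite Ejn e_sym; have := w_e n.-1; rewrite prednK //; lia.
  have [E|E] := w_N _ _ w_pred.
    by have : n.-1 = j; [apply: w_inj E; lia | lia].
  have [lt_j2|] := ltnP j.+2 n.
    have Enj : n = j.+3 by have : n.-1 = j.+2; [apply: w_inj E; lia | lia].
    by have := w_nb j.+1; rewrite Ejn Enj eqxx.
  move=> le_n; have Enj : n = j.+2 by lia.
  by have := w_e j.+1; rewrite Ejn Enj e_irr.
rewrite {j lt_jn}j0 in Ejn.
pose u (i : 'I_n) := w i.
have u_inj : injective u.
  by move=> a b /w_inj E; apply: val_inj; apply: E.
have u_succ i : e (u i) (u (ordS i)).
  rewrite /u /=; have := ltn_ord i; rewrite leq_eqVlt => /orP[/eqP Ei|lt_i].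
    by have := w_e i; rewrite Ei modnn Ejn.
  by rewrite modn_small.
have uN i : [set z | e (u i) z] = [set u (ordS i); u (ord_pred i)].
  apply/esym/eqP; rewrite eqEcard Ve cards2 (inj_eq u_inj) ordS_neq_pred //.
  rewrite andbT subUset !sub1set !inE u_succ /= e_sym.
  by rewrite -[i in X in e _ X]ord_predK u_succ.
have uT : [set u i | i : 'I_n] = setT.
  apply: (@connected_closed_full _ (u (Ordinal (ltnW (ltnW n_ge3))))).
    exact: imset_f.
  move=> _ z /imsetP[i _ ->] uz; have /setP/(_ z) := uN i.
  by rewrite !inE uz => /esym/orP[] /eqP ->; apply: imset_f.
have En : #|V| = n by rewrite -cardsT -uT card_imset // card_ord.
rewrite En; have [|h uK hK] := inj_card_bij u_inj; first by rewrite En card_ord.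
exists h => [|x y]; first by exists u.
have /setP/(_ y) := uN (h x); rewrite hK inE => ->.
by rewrite cycle_graphE -[y in RHS]hK !inE !(inj_eq u_inj).
Qed.

End RegularGraph.

(** * Periodicity of regular mixed graphs on a prime number of vertices *)

Theorem theorem1p3 (R : realType) (eta : R)
    (eta_range : 0 <= eta < 2 * pi)
    (eta_rat : exists q : rat, eta = ratr q * pi)
    (p : nat) (p_prime : prime p) (k : nat)
    (V : finType) (V_card : #|V| = p)
    (G : mixed_graph V) (G_regular : k_regular G k)
    (G_connected : weakly_connected G) :
  mg_periodic (eta_function G eta) <->
    ((3 <= p)%N /\ graph_iso (underlying G) (@cycle_graph p))
    \/ graph_iso (underlying G) (@path_graph 2).
Proof.
subst p; have V_gt1 := prime_gt1 p_prime.
have /card_gt0P[x0 _] := ltnW V_gt1.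
have Gk : regular_rel (underlying G) k := G_regular.
have k_gt0 := connected_regular_gt0 G_connected Gk V_gt1.
have k_lt := regular_lt_card (@underlying_irrefl _ G) Gk x0.
split=> [per|iso].
  have k_le2 : (k <= 2)%N.
    apply: periodic_degree_le2 G_regular p_prime _ _ per.
      by rewrite k_gt0.
    exact: eta_function_rev.
  case: k k_gt0 k_le2 Gk k_lt {G_regular} => [|[|[|]]] // _ _ Gk k_lt.
    right; apply: one_regular_iso Gk x0 => //.
    - exact: underlying_sym.
    - exact: underlying_irrefl.
  left; split=> //; apply: two_regular_iso Gk x0 => //.
  - exact: underlying_sym.
  - exact: underlying_irrefl.
have k12 : (0 < k <= 2)%N.
  rewrite k_gt0; case: iso => [[V_ge3 iso]|iso].
    by rewrite (graph_iso_regular iso Gk (cycle_graph_regular V_ge3) x0).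
  by rewrite (graph_iso_regular iso Gk path_graph2_regular x0).
have [q Eeta] := eta_rat; have /andP[eta_ge0 _] := eta_range.
have [N N_gt0 etaN] := expi_root_of_unity eta_ge0 Eeta.
apply: small_degree_periodic G_regular k12 N_gt0 _ => a; rewrite /eta_function.
case: ifP => _; first by case: ifP; rewrite ?expi0 ?expr1n.
have := congr1 (fun z => z ^+ N) (expiNK eta).
by rewrite exprMn etaN mul1r expr1n.
Qed.
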